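(* Let $A$ be a finite set of actions partitioned as $A=A^l\uplus A^r$, with $\mathcal{P}$, $\lesssim_{cc}$, $\mathcal{L}$, $\models$, $\leq$ and representation as in the context. Every formula $\phi\in\mathcal{L}$ is represented by some finite (possibly empty) set $M\subseteq\mathcal{P}$ of processes. Moreover, $\phi$ is represented by a single process $p\in\mathcal{P}$ if and only if $\phi$ is consistent and prime.
   Context: Process terms over $A$ are given by $p::=0\mid\omega\mid a.p\mid p+p$ with $a\in A$; the set of process terms is $\mathcal{P}$. Their transitions are the least relation satisfying: $\omega\xrightarrow{b}\omega$ for every $b\in A^l$; $a.p\xrightarrow{a}p$ for every $a\in A$; if $p\xrightarrow{a}p'$ then $p+q\xrightarrow{a}p'$ and $q+p\xrightarrow{a}p'$. A covariant-contravariant simulation is a relation $R\subseteq\mathcal{P}\times\mathcal{P}$ such that whenever $p\,R\,q$: for all $a\in A^r$ and all $p\xrightarrow{a}p'$ there is $q\xrightarrow{a}q'$ with $p'\,R\,q'$; and for all $b\in A^l$ and all $q\xrightarrow{b}q'$ there is $p\xrightarrow{b}p'$ with $p'\,R\,q'$. Write $p\lesssim_{cc}q$ iff some covariant-contravariant simulation contains $(p,q)$. The logic $\mathcal{L}$ has syntax $\varphi::=\bot\mid\top\mid\varphi\land\varphi\mid\varphi\lor\varphi\mid[b]\varphi\mid\langle a\rangle\varphi$ with $a\in A^r$, $b\in A^l$; $\bot,\top,\land,\lor$ have the usual meaning, $p\models[b]\varphi$ iff $p'\models\varphi$ for all $p\xrightarrow{b}p'$, and $p\models\langle a\rangle\varphi$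 iff $p'\models\varphi$ for some $p\xrightarrow{a}p'$. Write $\phi\leq\psi$ iff every $p\in\mathcal{P}$ with $p\models\phi$ satisfies $p\models\psi$. A formula $\phi$ is consistent iff $p\models\phi$ for some $p\in\mathcal{P}$; it is prime iff for all $\phi_1,\phi_2\in\mathcal{L}$, $\phi\leq\phi_1\lor\phi_2$ implies $\phi\leq\phi_1$ or $\phi\leq\phi_2$. A formula $\phi$ is represented by a process $p\in\mathcal{P}$ iff for all $q\in\mathcal{P}$: $q\models\phi\iff p\lesssim_{cc}q$; it is represented by a finite set $M\subseteq\mathcal{P}$ iff for all $q\in\mathcal{P}$: $q\models\phi\iff\exists p\in M.\ p\lesssim_{cc}q$. *)

(* Defs.v *)
From HB Require Import structures.
From mathcomp Require Import all_boot finmap.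

Set Implicit Arguments.
Unset Strict Implicit.
Unset Printing Implicit Defensive.

Inductive process (A : Type) : Type :=
| Zero
| Omega
| Prefix of A & process A
| Plus of process A & process A.

Arguments Zero {A}.
Arguments Omega {A}.

(* Encoding into generic trees, used only to equip [process A] with the
   [choiceType] structure that [{fset process A}] requires. *)
Section ProcessEncoding.
Variable A : Type.

Fixpoint process_encode (p : process A) : GenTree.tree A :=
  match p with
  | Zero => GenTree.Node 0 [::]
  | Omega => GenTree.Node 1 [::]
  | Prefix a p => GenTree.Node 2 [:: GenTree.Leaf a; process_encode p]
  | Plus p q => GenTree.Node 3 [:: process_encode p; process_encode q]
  end.

Fixpoint process_decode (t : GenTree.tree A) : option (process A) :=
  match t with
  | GenTree.Node 0 [::] => Some Zero
  | GenTree.Node 1 [::] => Some Omega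
  | GenTree.Node 2 [:: GenTree.Leaf a; t] => omap (Prefix a) (process_decode t)
  | GenTree.Node 3 [:: t; u] =>
      if (process_decode t, process_decode u) is (Some p, Some q)
      then Some (Plus p q) else None
  | _ => None
  end.

Lemma process_encodeK : pcancel process_encode process_decode.
Proof. by elim=> [||a p /= ->|p /= -> q ->]. Qed.

End ProcessEncoding.

HB.instance Definition _ (A : choiceType) :=
  Choice.copy (process A) (pcan_type (@process_encodeK A)).

Section CovariantContravariant.
Variables (A : finType) (Al Ar : {set A}).

Inductive step : process A -> A -> process A -> Prop :=
| step_omega b : b \in Al -> step Omega b Omega
| step_prefix a p : step (Prefix a p) a p
| step_plusl p q a p' : step p a p' -> step (Plus p q) a p'
| step_plusr p q a p' : step p a p' -> step (Plus q p) a p'.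

Definition cc_simulation (R : process A -> process A -> Prop) : Prop :=
  forall p q, R p q ->
    (forall a p', a \in Ar -> step p a p' ->
       exists q', step q a q' /\ R p' q') /\
    (forall b q', b \in Al -> step q b q' ->
       exists p', step p b p' /\ R p' q').

Definition cc_le (p q : process A) : Prop :=
  exists R, cc_simulation R /\ R p q.

Inductive formula : Type :=
| Bot
| Top
| And of formula & formula
| Or of formula & formula
| Box (b : A) of b \in Al & formula
| Diamond (a : A) of a \in Ar & formula.

Fixpoint sat (p : process A) (phi : formula) : Prop :=
  match phi with
  | Bot => False
  | Top => True
  | And phi psi => sat p phi /\ sat p psi
  | Or phi psi => sat p phi \/ sat p psi
  | @Box b _ phi => forall p', step p b p' -> sat p' phi
  | @Diamond a _ phi => exists p', step p a p' /\ sat p' phi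
  end.

Definition entails (phi psi : formula) : Prop :=
  forall p, sat p phi -> sat p psi.

Definition consistent (phi : formula) : Prop := exists p, sat p phi.

Definition prime_formula (phi : formula) : Prop :=
  forall phi1 phi2, entails phi (Or phi1 phi2) ->
    entails phi phi1 \/ entails phi phi2.

Definition represented_by (phi : formula) (p : process A) : Prop :=
  forall q, sat q phi <-> cc_le p q.

Definition represented_by_set (phi : formula) (M : {fset process A}) : Prop :=
  forall q, sat q phi <-> exists p, p \in M /\ cc_le p q.

End CovariantContravariant.

(* Main.v *)
(** A covariant-contravariant simulation problem [p <= r] unfolds into
    independent requirements: a witness in [r] for each [Ar]-transition of [p]
    and, for each [b] in [Al], a bound on all [b]-derivatives of [r].  As [Al]
    and [Ar] are disjoint, any such system of requirements is the set of
    processes above a single sum of prefixes.  So boxes and diamonds of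
    represented formulas are represented, and two processes have a least upper
    bound, which handles conjunction.  Conversely every process has a
    characteristic formula; a prime formula below the disjunction of the
    characteristic formulas of its representatives is below one of them. *)
Require Import Defs.
From mathcomp Require Import all_boot finmap.

Set Implicit Arguments.
Unset Strict Implicit.
Unset Printing Implicit Defensive.

Section Representation.
Variables (A : finType) (Al Ar : {set A}).

Local Notation process := (process A).
Local Notation step := (step Al).
Local Notation cc_le := (cc_le Al Ar).
Local Notation formula := (formula Al Ar).

Implicit Types (p q r : process) (phi psi : formula) (S : process -> Prop).

(** * The preorder and its transfer of satisfaction *)

Lemma cc_leE p r :
  cc_le p r <->
  (forall a p', a \in Ar -> step p a p' ->
     exists r', step r a r' /\ cc_le p' r') /\
  (forall b r', b \in Al -> step r b r' ->
     exists p', step p b p' /\ cc_le p' r').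
Proof.
have unfold q s : cc_le q s ->
    (forall a q', a \in Ar -> step q a q' ->
       exists s', step s a s' /\ cc_le q' s') /\
    (forall b s', b \in Al -> step s b s' ->
       exists q', step q b q' /\ cc_le q' s').
  case=> R [simR Rqs]; have [fwd bwd] := simR _ _ Rqs; split.
    move=> a q' Ha /(fwd _ _ Ha) [s' [ss' Rs']].
    by exists s'; split=> //; exists R.
  move=> b s' Hb /(bwd _ _ Hb) [q' [qq' Rq']].
  by exists q'; split=> //; exists R.
split=> [/unfold//|[fwd bwd]].
(* Adding the single pair [(p, r)] to [cc_le] keeps it a simulation, since the derivatives are
   matched inside [cc_le]. *)
exists (fun q s => cc_le q s \/ q = p /\ s = r); split; last by right.
move=> q s [/unfold [fwd' bwd']|[-> ->]]; split.
- by move=> a q' Ha /(fwd' _ _ Ha) [s' [? ?]]; exists s'; split=> //; left.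
- by move=> b s' Hb /(bwd' _ _ Hb) [q' [? ?]]; exists q'; split=> //; left.
- by move=> a q' Ha /(fwd _ _ Ha) [s' [? ?]]; exists s'; split=> //; left.
- by move=> b s' Hb /(bwd _ _ Hb) [q' [? ?]]; exists q'; split=> //; left.
Qed.

Lemma cc_le_refl p : cc_le p p.
Proof.
exists eq; split=> // q _ <-; split=> [a|b] q' _ qq'; by exists q'.
Qed.

(** By disjointness [Omega] has no [Ar]-move to be matched, and its loops answer every [Al]-move of
    [p]. It is therefore the neutral element for joins and the representative of [Top]. *)
Lemma Omega_le p : [disjoint Al & Ar] -> cc_le Omega p.
Proof.
move=> hdisj; exists (fun q _ => q = Omega); split=> // q r ->.
split=> [a q' Ha|b r' Hb _]; last by exists Omega; split=> //; constructor.
inversion 1; subst; by rewrite (disjointFr hdisj) in Ha.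
Qed.

(** Diamonds carry labels in [Ar] and boxes labels in [Al], which are exactly the directions in
    which a simulation transfers moves. *)
Lemma sat_cc_le phi p q : cc_le p q -> sat p phi -> sat q phi.
Proof.
elim: phi p q => [||phi IH1 psi IH2|phi IH1 psi IH2|b Hb phi IH|a Ha phi IH] //=
  p q pq.
- by move=> [? ?]; split; [apply: IH1 pq _|apply: IH2 pq _].
- by case=> ?; [left; apply: IH1 pq _|right; apply: IH2 pq _].
- move=> satp q' qq'; have [_ /(_ b q' Hb qq') [p' [pp' le']]] := (cc_leE p q).1 pq.
  by apply: IH le' _; apply: satp.
- case=> p' [pp' satp']; have [/(_ a p' Ha pp') [q' [qq' le']] _] := (cc_leE p q).1 pq.
  by exists q'; split=> //; apply: IH le' _.
Qed.

(** * Transitions of processes *)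

(** The loops of [Omega] are the only obstacle to induction along transitions, so [Omega] becomes
    the base case. *)
Lemma process_step_ind (P : process -> Prop) :
  P Omega -> (forall p, (forall a p', step p a p' -> P p') -> P p) ->
  forall p, P p.
Proof.
(* A derivative of [Plus p q] is a derivative of a summand, not a summand, so the structural
   induction must carry the derivatives along. *)
move=> P0 PS p; suff [] : P p /\ forall a p', step p a p' -> P p' by [].
elim: p => [||a p [IHp IHp']|p [IHp IHp'] q [IHq IHq']].
- have noStep a p' : step Zero a p' -> P p' by inversion 1.
  by split=> //; apply: PS.
- by split=> // a p'; inversion 1.
- have IH b p' : step (Prefix a p) b p' -> P p' by inversion 1; subst.
  by split=> //; apply: PS.
- have IH b p' : step (Plus p q) b p' -> P p'.
    by inversion 1; subst; [apply: IHp' H4|apply: IHq' H4].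
  by split=> //; apply: PS.
Qed.

Lemma finite_branching p :
  exists s : seq (A * process), forall a p', step p a p' <-> (a, p') \in s.
Proof.
elim: p => [||a p _|p [s Hs] q [t Ht]].
- by exists [::] => a p'; split=> //; inversion 1.
- exists [seq (b, Omega) | b <- enum Al] => a p'; split.
    by inversion 1; subst; apply/mapP; exists a; rewrite ?mem_enum.
  by case/mapP=> b; rewrite mem_enum => Hb [-> ->]; constructor.
- exists [:: (a, p)] => b p'; rewrite inE; split.
    by inversion 1; subst.
  by move/eqP=> [-> ->]; constructor.
- exists (s ++ t) => a p'; rewrite mem_cat; split.
    by inversion 1; subst; apply/orP; [left; apply/Hs|right; apply/Ht].
  by case/orP=> [/Hs|/Ht] ?; [apply: step_plusl|apply: step_plusr].
Qed.

Definition prefix_sum (s : seq (A * process)) : process :=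
  foldr (fun x => Plus (Prefix x.1 x.2)) Zero s.

Lemma step_prefix_sum (s : seq (A * process)) a p :
  step (prefix_sum s) a p <-> (a, p) \in s.
Proof.
elim: s => [|[b q] s IH] /=; first by split=> //; inversion 1.
rewrite inE; split.
  inversion 1; subst; last by apply/orP; right; apply/IH.
  by inversion H4; subst; rewrite eqxx.
case/orP=> [/eqP [-> ->]|/IH ?]; last exact: step_plusr.
by apply: step_plusl; constructor.
Qed.

(** * Finite unions of cones *)

(** Stated for predicates rather than formulas, because the intermediate sets, such as bounds on
    derivatives, are not given by formulas. *)
Definition finitely_represented S : Prop :=
  exists M : seq process, forall r, S r <-> exists2 p, p \in M & cc_le p r.

Lemma finitely_represented_ext S S' :
  (forall r, S r <-> S' r) -> finitely_represented S -> finitely_represented S'.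
Proof. by move=> SS' [M HM]; exists M => r; rewrite -SS'. Qed.

Lemma finitely_represented_cone p : finitely_represented (cc_le p).
Proof.
exists [:: p] => r; split=> [pr|[q]]; first by exists p; rewrite ?inE.
by rewrite inE => /eqP ->.
Qed.

Lemma finitely_representedU S S' :
  finitely_represented S -> finitely_represented S' ->
  finitely_represented (fun r => S r \/ S' r).
Proof.
move=> [M HM] [N HN]; exists (M ++ N) => r; rewrite HM HN; split.
  by case=> -[p Hp pr]; exists p; rewrite // mem_cat Hp ?orbT.
by case=> p; rewrite mem_cat => /orP [] Hp pr; [left|right]; exists p.
Qed.

Lemma finitely_represented_bigU (T : eqType) (s : seq T)
    (F : T -> process -> Prop) :
  (forall x, x \in s -> finitely_represented (F x)) ->
  finitely_represented (fun r => exists2 x, x \in s & F x r).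
Proof.
elim: s => [_|y s IH fin]; first by exists [::] => r; split=> -[].
have fin_s x : x \in s -> finitely_represented (F x).
  by move=> xs; apply: fin; rewrite inE xs orbT.
have := finitely_representedU (fin y (mem_head _ _)) (IH fin_s).
apply: finitely_represented_ext => r; split.
  case=> [Fy|[x xs Fx]]; first by exists y; rewrite ?mem_head.
  by exists x; rewrite // inE xs orbT.
case=> x; rewrite inE => /orP [/eqP ->|xs] Fx; first by left.
by right; exists x.
Qed.

(** The [Ar]-prefixes of the sum are the demands listed in [D]; its [b]-prefixes, for [b] in [Al],
    lead to the representatives of [F b] and so bound the [b]-derivatives of [r]. Disjointness keeps
    the two groups from interfering. *)
Lemma requirements_represented (D : seq (A * process))
    (F : A -> process -> Prop) :
  [disjoint Al & Ar] -> (forall b, finitely_represented (F b)) ->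
  exists p, forall r, cc_le p r <->
    (forall a q, (a, q) \in D -> a \in Ar ->
       exists r', step r a r' /\ cc_le q r') /\
    (forall b r', b \in Al -> step r b r' -> F b r').
Proof.
move=> hdisj /fin_all_exists [M HM].
(* The filter matters: an entry of [D] labelled in [Al] would permit further [Al]-moves of [r]. *)
exists (prefix_sum ([seq x <- D | x.1 \in Ar] ++
                    [seq (b, m) | b <- enum Al, m <- M b])) => r.
have stepl b q : b \in Al -> step (prefix_sum ([seq x <- D | x.1 \in Ar] ++
    [seq (b, m) | b <- enum Al, m <- M b])) b q <-> q \in M b.
  move=> Hb; rewrite step_prefix_sum mem_cat mem_filter /=.
  rewrite (disjointFr hdisj Hb) /=; split.
    by case/allpairsPdep=> c [m [_ mM [-> ->]]].
  by move=> qM; apply/allpairsPdep; exists b, q; rewrite mem_enum.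
have stepr a q : a \in Ar -> step (prefix_sum ([seq x <- D | x.1 \in Ar] ++
    [seq (b, m) | b <- enum Al, m <- M b])) a q <-> (a, q) \in D.
  move=> Ha; rewrite step_prefix_sum mem_cat mem_filter /= Ha /=; split.
    case/orP=> // /allpairsPdep [c [m []]]; rewrite mem_enum => Hc _ [ac _].
    by rewrite -ac (disjointFl hdisj Ha) in Hc.
  by move=> ->.
rewrite cc_leE; split=> -[fwd bwd]; split.
- by move=> a q aqD Ha; apply: fwd => //; apply/stepr.
- move=> b r' Hb /(bwd _ _ Hb) [q [/(stepl _ _ Hb) qM qr']].
  by apply/HM; exists q.
- by move=> a q Ha /(stepr _ _ Ha) /fwd; apply.
- move=> b r' Hb /(bwd _ _ Hb) /HM [q qM qr'].
  by exists q; split=> //; apply/stepl.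
Qed.

(** A process above both [p] and [q] must match the [Ar]-moves of each, while each of its
    [b]-derivatives must lie above a [b]-derivative of [p] and one of [q]. Induction on [p] alone,
    with [q] arbitrary, supplies the joins of such derivatives. *)
Lemma cc_join_exists p q : [disjoint Al & Ar] ->
  exists j, forall r, cc_le j r <-> cc_le p r /\ cc_le q r.
Proof.
move=> hdisj; elim/process_step_ind: p q => [|p IH] q.
  by exists q => r; split=> [|[]//]; split=> //; apply: Omega_le.
have [s Hs] := finite_branching p; have [t Ht] := finite_branching q.
pose F b r := exists2 x, x \in s &
  exists2 y, y \in t & [/\ x.1 = b, y.1 = b, cc_le x.2 r & cc_le y.2 r].
have finF b : finitely_represented (F b).
  apply: finitely_represented_bigU => -[a p'] /Hs /IH join_p'.
  apply: finitely_represented_bigU => -[c q'] _ /=.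
  (* A pair of derivatives not both reached by [b] contributes the empty set. *)
  have [<-|ab] := eqVneq a b; last first.
    by exists [::] => r; split=> -[] // ab'; rewrite ab' eqxx in ab.
  have [<-|ca] := eqVneq c a; last first.
    by exists [::] => r; split=> -[] // _ ca'; rewrite ca' eqxx in ca.
  have [j Hj] := join_p' q'.
  apply: finitely_represented_ext (finitely_represented_cone j) => r.
  by rewrite Hj; split=> [] [].
have [j Hj] := requirements_represented (s ++ t) hdisj finF.
exists j => r; rewrite Hj (cc_leE p) (cc_leE q); split.
  case=> fwd bwd; split; split.
  - by move=> a p' Ha /Hs H; apply: fwd => //; rewrite mem_cat H.
  - move=> b r' Hb /(bwd _ _ Hb) [[c p'] /Hs /= H] [y _ [cb _ le _]].
    by exists p'; rewrite -cb.
  - by move=> a q' Ha /Ht H; apply: fwd => //; rewrite mem_cat H orbT.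
  - move=> b r' Hb /(bwd _ _ Hb) [x _ [[c q'] /Ht /= H [_ cb _ le]]].
    by exists q'; rewrite -cb.
case=> -[fwdp bwdp] [fwdq bwdq]; split.
  move=> a q'; rewrite mem_cat => /orP [/Hs|/Ht] H Ha; first exact: fwdp.
  exact: fwdq.
move=> b r' Hb rr'.
have [p' [/Hs pp' lep]] := bwdp _ _ Hb rr'.
have [q' [/Ht qq' leq]] := bwdq _ _ Hb rr'.
by exists (b, p') => //; exists (b, q').
Qed.

Lemma formula_finitely_represented phi :
  [disjoint Al & Ar] -> finitely_represented (fun r => sat r phi).
Proof.
move=> hdisj.
have finT : finitely_represented (fun=> True).
  apply: finitely_represented_ext (finitely_represented_cone Omega) => r.
  by split=> // _; apply: Omega_le.
elim: phi => [||phi [M HM] psi [N HN]|phi IH1 psi IH2|b Hb phi IH|a Ha phi IH] //=.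
- by exists [::] => r; split=> -[].
(* Two unions of cones intersect in the union of the pairwise intersections, each of which is the
   cone of a join. *)
- have fin : finitely_represented (fun r =>
      exists2 p, p \in M & exists2 q, q \in N & cc_le p r /\ cc_le q r).
    apply: finitely_represented_bigU => p _.
    apply: finitely_represented_bigU => q _.
    have [j Hj] := cc_join_exists p q hdisj.
    exact: finitely_represented_ext Hj (finitely_represented_cone j).
  apply: finitely_represented_ext fin => r; rewrite HM HN; split.
    by case=> p pM [q qN [pr qr]]; split; [exists p|exists q].
  by case=> -[p pM pr] [q qN qr]; exists p => //; exists q.
- exact: finitely_representedU.
(* Only [b]-derivatives are constrained; for any other label the bound is the full set, represented
   by [Omega]. *)
- have finF c : finitely_represented (fun r => c = b -> sat r phi).
    have [->|/eqP cb] := eqVneq c b.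
      by apply: finitely_represented_ext IH => r; split=> [//|]; apply.
    by apply: finitely_represented_ext finT => r; split.
  have [p Hp] := requirements_represented [::] hdisj finF.
  apply: finitely_represented_ext (finitely_represented_cone p) => r.
  rewrite Hp; split=> [[_ bwd] r' rr'|satr]; first exact: bwd rr' _.
  by split=> // c r' _ rr' cb; apply: satr; rewrite -cb.
- have [M HM] := IH.
  (* The diamond distributes over the union of cones: each [p] in [M] gives one demand [(a, p)],
     with no bound on [Al]-moves. *)
  have fin : finitely_represented (fun r =>
      exists2 p, p \in M & exists r', step r a r' /\ cc_le p r').
    apply: finitely_represented_bigU => p _.
    have [j Hj] := requirements_represented [:: (a, p)] hdisj (fun=> finT).
    apply: finitely_represented_ext (finitely_represented_cone j) => r.
    rewrite Hj; split=> [[fwd _]|Hr]; first by apply: fwd; rewrite ?mem_head.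
    by split=> // c q; rewrite inE => /eqP [-> ->].
  apply: finitely_represented_ext fin => r; split.
    by case=> p pM [r' [rr' pr']]; exists r'; split=> //; apply/HM; exists p.
  by case=> r' [rr' /HM [p pM pr']]; exists p => //; exists r'.
Qed.

(** * Definable sets, characteristic formulas and primality *)

Definition definable S : Prop :=
  exists phi, forall r, sat r phi <-> S r.

Lemma definable_bigU (T : eqType) (s : seq T) (F : T -> process -> Prop) :
  (forall x, x \in s -> definable (F x)) ->
  definable (fun r => exists2 x, x \in s & F x r).
Proof.
elim: s => [_|y s IH def]; first by exists (Bot Al Ar) => r; split=> -[].
have [phi Hphi] := def y (mem_head _ _).
have [|psi Hpsi] := IH; first by move=> x xs; apply: def; rewrite inE xs orbT.
exists (Or phi psi) => r /=; rewrite Hphi Hpsi; split.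
  case=> [Fy|[x xs Fx]]; first by exists y; rewrite ?mem_head.
  by exists x; rewrite // inE xs orbT.
case=> x; rewrite inE => /orP [/eqP ->|xs] Fx; first by left.
by right; exists x.
Qed.

Lemma definable_bigI (T : eqType) (s : seq T) (F : T -> process -> Prop) :
  (forall x, x \in s -> definable (F x)) ->
  definable (fun r => forall x, x \in s -> F x r).
Proof.
elim: s => [_|y s IH def]; first by exists (Top Al Ar).
have [phi Hphi] := def y (mem_head _ _).
have [|psi Hpsi] := IH; first by move=> x xs; apply: def; rewrite inE xs orbT.
exists (And phi psi) => r /=; rewrite Hphi Hpsi; split.
  by case=> Fy Fs x; rewrite inE => /orP [/eqP ->//|/Fs].
by move=> Fs; split=> [|x xs]; apply: Fs; rewrite inE ?eqxx // xs orbT.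
Qed.

(** The formula transcribes [cc_leE]: a diamond for each [Ar]-move of [p], and for each [b] in [Al]
    a box over the disjunction of the characteristic formulas of the [b]-derivatives. For [Omega] it
    is [Top]. *)
Lemma characteristic_formula p : [disjoint Al & Ar] -> definable (cc_le p).
Proof.
move=> hdisj; elim/process_step_ind: p => [|p IH].
  by exists (Top Al Ar) => r; split=> // _; apply: Omega_le.
have [s Hs] := finite_branching p.
have [x xs|phi Hphi] := @definable_bigI _ s (fun x r => x.1 \in Ar ->
    exists r', step r x.1 r' /\ cc_le x.2 r').
  case: x xs => a p' /Hs /IH [chi Hchi] /=.
  case: (boolP (a \in Ar)) => Ha; last by exists (Top Al Ar).
  exists (Diamond Ha chi) => r /=; split.
    by case=> r' [rr' /Hchi ?] _; exists r'.
  by case=> // r' [rr' /Hchi ?]; exists r'.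
(* The conjunction ranges over all labels, not only those of moves of [p]: where [p] has no [b]-move
   the disjunction is unsatisfiable and the box forbids [b] in [r]. *)
have [b _|psi Hpsi] := @definable_bigI _ (enum A) (fun b r => b \in Al ->
    forall r', step r b r' -> exists2 x, x \in s & x.1 = b /\ cc_le x.2 r').
  case: (boolP (b \in Al)) => Hb; last by exists (Top Al Ar).
  have [x xs|chi Hchi] :=
      @definable_bigU _ s (fun x r' => x.1 = b /\ cc_le x.2 r').
    case: x xs => a p' /Hs /IH [chi Hchi] /=.
    have [ab|/eqP ab] := eqVneq a b; last by exists (Bot Al Ar) => r; split=> -[].
    by exists chi => r; rewrite Hchi; split=> [|[]].
  exists (Box Hb chi) => r /=; split=> [H _ r' /H /Hchi //|H r' rr'].
  by apply/Hchi; apply: H.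
exists (And phi psi) => r /=; rewrite Hphi Hpsi cc_leE.
split=> -[fwd bwd]; split.
- by move=> a p' Ha /Hs /fwd; apply.
- move=> b r' Hb /(bwd _ (mem_enum _ _) Hb) [[a p'] /Hs pp' /= [ab le]].
  by exists p'; rewrite -ab.
- by move=> [a p'] /Hs pp' Ha; apply: fwd.
- move=> b _ Hb r' /(bwd _ _ Hb) [p' [/Hs pp' le]].
  by exists (b, p').
Qed.

(** Binary primality is iterated along the list, and consistency excludes the empty list.
    Definability is needed because primality speaks only of disjunctions of formulas. *)
Lemma prime_below_bigU phi (T : eqType) (s : seq T) (F : T -> process -> Prop) :
  consistent phi -> prime_formula phi ->
  (forall x, x \in s -> definable (F x)) ->
  (forall r, sat r phi -> exists2 x, x \in s & F x r) ->
  exists2 x, x \in s & forall r, sat r phi -> F x r.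
Proof.
move=> [r0 sat0] prime; elim: s => [_ /(_ r0 sat0) []//|y s IH def below].
have def_s x : x \in s -> definable (F x).
  by move=> xs; apply: def; rewrite inE xs orbT.
have [chi Hchi] := def y (mem_head _ _).
have [psi Hpsi] := definable_bigU def_s.
have [r /below [x]|Hy|Hs] := prime chi psi.
- rewrite inE => /orP [/eqP ->|xs] Fx; first by left; apply/Hchi.
  by right; apply/Hpsi; exists x.
- by exists y => [|r /Hy /Hchi]; rewrite ?mem_head.
- have [r /Hs /Hpsi //|x xs Hx] := IH def_s.
  by exists x => //; rewrite inE xs orbT.
Qed.

End Representation.

Theorem theorem16 (A : finType) (Al Ar : {set A})
    (hcover : Al :|: Ar = [set: A]) (hdisj : [disjoint Al & Ar])
    (phi : formula Al Ar) :
  (exists M : {fset process A}, represented_by_set phi M) /\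
  ((exists p : process A, represented_by phi p) <->
   consistent phi /\ prime_formula phi).
Proof.
have [M HM] := formula_finitely_represented phi hdisj; split.
  exists (seq_fset tt M) => q; rewrite HM; split.
    by case=> p pM pq; exists p; rewrite seq_fsetE.
  by case=> p [pM pq]; exists p; rewrite seq_fsetE in pM *.
split=> [[p Hp]|[cons prime]].
  (* [p] is a least model of [phi], so whichever disjunct holds at [p] holds at every model. *)
  have satp : sat p phi by apply/Hp; apply: cc_le_refl.
  split=> [|phi1 phi2 /(_ p satp) sat12]; first by exists p.
  by case: sat12 => sati; [left|right] => q /Hp pq; apply: sat_cc_le pq sati.
(* Primality puts all models of [phi] into the cone of one representative [p]; that cone consists of
   models because [p] is in [M]. *)
have [x _|r /HM //|p pM Hp] :=
    @prime_below_bigU _ _ _ _ _ M (cc_le Al Ar) cons prime.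
  exact: characteristic_formula.
by exists p => q; split=> [/Hp//|pq]; apply/HM; exists p.
Qed.
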